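(* For every integer $n\geq 1$, $$\sum_{\pi\in P^{\pm}(\{1,1,2,2,\ldots,n,n\})} t^{\operatorname{des}(\pi)}=\sum_{{\bf e}\in\mathfrak{I}_{2n}^{(1,4,3,8,\ldots,2n-1,4n)}}t^{\operatorname{asc}({\bf e})}.$$
   Context: For a sequence of positive integers ${\bf s}=(s_1,\ldots,s_N)$, the set of ${\bf s}$-inversion sequences is $\mathfrak{I}_N^{({\bf s})}=\{(e_1,\ldots,e_N)\in\mathbb Z^N: 0\le e_i<s_i \text{ for } 1\le i\le N\}$. The ascent set of ${\bf e}$ is $\operatorname{Asc}({\bf e})=\{0\le i<N : e_i/s_i<e_{i+1}/s_{i+1}\}$ with the convention $e_0=0$, $s_0=1$, and $\operatorname{asc}({\bf e})=|\operatorname{Asc}({\bf e})|$. Here ${\bf s}=(1,4,3,8,\ldots,2n-1,4n)$ is the sequence of length $2n$ with $s_{2j-1}=2j-1$ and $s_{2j}=4j$ for $1\le j\le n$. $P^{\pm}(\{1,1,2,2,\ldots,n,n\})$ is the set of signed permutations of the multiset $\{1,1,2,2,\ldots,n,n\}$: words $\pi_1\cdots\pi_{2n}$ of nonzero integers such that $|\pi_1|\cdots|\pi_{2n}|$ is a permutation (arrangement) of the multiset and each entry carries an arbitrary sign (there are $2^{2n}(2n)!/2^n$ of them). For a word $\pi=\pi_1\cdots\pi_m$ of integers, a descent is an index $i\in\{0,1,\ldots,m-1\}$ with $\pi_i>\pi_{i+1}$, using the convention $\pi_0=0$; $\operatorname{des}(\pi)$ is the number of descents. *)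

(* Defs.v *)
From HB Require Import structures.
From mathcomp Require Import all_boot all_order all_algebra.

Set Implicit Arguments.
Unset Strict Implicit.
Unset Printing Implicit Defensive.

Import Order.TTheory GRing.Theory Num.Theory.
Local Open Scope ring_scope.

(* A sequence (s_1, ..., s_N) of positive integers is given by a function
   s : nat -> nat of which only the values s 1, ..., s N matter.  Coordinates of
   e are indexed from 0 by 'I_N, so that e i is the entry e_(i+1). *)
Definition inversion_seq (N : nat) (s : nat -> nat) : finType :=
  {dffun forall i : 'I_N, 'I_(s i.+1)}.

(* Paper indexing: inv_entry e 0 = 0 and inv_entry e i.+1 = e_(i+1) for i < N. *)
Definition inv_entry (N : nat) (s : nat -> nat) (e : inversion_seq N s)
    (i : nat) : nat :=
  nth 0%N (0%N :: [seq nat_of_ord (e k) | k <- enum 'I_N]) i.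

Definition inv_base (s : nat -> nat) (i : nat) : nat :=
  if i is 0%N then 1%N else s i.

Definition inv_ratio (N : nat) (s : nat -> nat) (e : inversion_seq N s)
    (i : nat) : rat :=
  (inv_entry e i)%:R / (inv_base s i)%:R.

Definition Asc (N : nat) (s : nat -> nat) (e : inversion_seq N s) : {set 'I_N} :=
  [set i : 'I_N | inv_ratio e i < inv_ratio e i.+1].

Definition asc (N : nat) (s : nat -> nat) (e : inversion_seq N s) : nat :=
  #|Asc e|.

(* 1, 4, 3, 8, 5, 12, ... for i = 1, 2, 3, ... *)
Definition s_1438 (i : nat) : nat := if odd i then i else (4 * i./2)%N.

Definition Des (w : seq int) : {set 'I_(size w)} :=
  [set i : 'I_(size w) | nth 0 (0 :: w) i > nth 0 (0 :: w) i.+1].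

Definition des (w : seq int) : nat := #|Des w|.

(* The nonzero integers of absolute value at most n, as a finite type: the pair
   (b, k) stands for (-1)^b (k+1). *)
Definition letter (n : nat) : finType := (bool * 'I_n)%type.

Definition letter_val (n : nat) (x : letter n) : int :=
  (-1) ^+ x.1 * (x.2.+1)%:Z.

Definition word_val (n : nat) (w : seq (letter n)) : seq int :=
  [seq letter_val x | x <- w].

(* [:: 1; 1; 2; 2; ...; n; n] *)
Definition double_multiset (n : nat) : seq nat :=
  flatten [seq [:: j; j] | j <- iota 1 n].

Definition signed_multiperm (n : nat) : {set (2 * n).-tuple (letter n)} :=
  [set w : (2 * n).-tuple (letter n) |
    perm_eq [seq absz x | x <- word_val w] (double_multiset n)].

(* Main.v *)
Require Import Defs.
From mathcomp Require Import all_boot all_order all_algebra.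
From mathcomp Require Import zify ring.

Set Implicit Arguments.
Unset Strict Implicit.
Unset Printing Implicit Defensive.

Import Order.TTheory GRing.Theory Num.Theory.
Local Open Scope ring_scope.

(** Divided by (1 - X)^(2n+1), both sides become the power series whose m-th
    coefficient is ((2m+1)(m+1))^n.

    Inversion sequences: the m-th coefficient counts the lecture hall sequences
    0 <= l_1/s_1 <= ... <= l_(2n)/s_(2n) <= m. Writing l_i = s_i * q_i - e_i
    with 0 <= e_i < s_i, an ascent of e forces q to increase strictly. Refined
    by a bound on the last entry, these counts have closed product formulas
    that satisfy the recurrence in the length.

    Signed words: the m-th coefficient counts the pairs (w, c) where w is a
    signed word and 0 <= c_1 <= ... <= c_(2n) <= m increases strictly at the
    descents of w. Equivalently, the pairs (c_i, w_i) are >= (0, 0) and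
    lexicographically sorted, so (w, c) amounts to choosing, independently for
    each j, a multiset of two elements among the 2m + 1 pairs (v, j), (v, -j)
    that are >= (0, 0). *)

(** * Coefficients of polynomials divided by powers of 1 - X *)

(* [divcoef N p m] is the coefficient of [X^m] in the power series
   [p / (1 - X)^N]. *)
Fixpoint divcoef (N : nat) (p : {poly int}) (m : nat) : int :=
  if N is N'.+1 then \sum_(i < m.+1) divcoef N' p i else p`_m.

Lemma divcoef_sum (I : Type) (r : seq I) (P : pred I) (F : I -> {poly int})
    N m :
  divcoef N (\sum_(i <- r | P i) F i) m = \sum_(i <- r | P i) divcoef N (F i) m.
Proof.
elim: N m => [|N IHN] m /=; first exact: coef_sum.
by rewrite exchange_big /=; apply: eq_bigr => i _; rewrite IHN.
Qed.

Lemma divcoefXM N p m :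
  divcoef N ('X * p) m = if m is m'.+1 then divcoef N p m' else 0.
Proof.
elim: N m => [|N IHN] m /=; first by rewrite coefXM; case: m.
rewrite big_ord_recl /= IHN add0r; case: m => [|m]; first by rewrite big_ord0.
by apply: eq_bigr => i _; rewrite IHN.
Qed.

(** Successive differences recover a sequence from its partial sums, so the factors 1 / (1 - X) are
    removed one at a time. *)
Lemma divcoef_inj N p q : divcoef N p =1 divcoef N q -> p = q.
Proof.
elim: N => [|N IHN] eq_pq; first by apply/polyP.
apply: IHN => -[|m]; first by have := eq_pq 0; rewrite /= !big_ord1.
have := eq_pq m.+1; rewrite /= big_ord_recr [in RHS]big_ord_recr /=.
by have /= -> := eq_pq m; move/addrI.
Qed.

(** * Inversion sequences extended by a last entry *)

Lemma ord_geq_max N (i : 'I_N.+1) : (N <= i)%N -> N = i.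
Proof. by move=> le_Ni; apply/anti_leq; rewrite le_Ni -ltnS ltn_ord. Qed.

Lemma inv_seq_val_eq N s (e : inversion_seq N s) (i j : 'I_N) :
  i = j :> nat -> e i = e j :> nat.
Proof. by move/val_inj->. Qed.

Section InvRcons.
Variables (N : nat) (s : nat -> nat).

(** The type of an entry depends on its index, so the new entry is cast along [N = i]; matching on
    [ltnP] makes the proof of [N <= i] available. *)
Definition inv_rcons_fun (e : inversion_seq N s) (k : 'I_(s N.+1))
    (i : 'I_N.+1) : 'I_(s i.+1) :=
  match ltnP i N with
  | LtnNotGeq lt_iN => e (Ordinal lt_iN)
  | GeqNotLtn le_Ni =>
      cast_ord (congr1 (fun j => s j.+1) (ord_geq_max le_Ni)) k
  end.

Definition inv_rcons (e : inversion_seq N s) (k : 'I_(s N.+1)) :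
  inversion_seq N.+1 s := [ffun i => inv_rcons_fun e k i].

Definition inv_belast (e : inversion_seq N.+1 s) : inversion_seq N s :=
  [ffun i : 'I_N => (e (widen_ord (leqnSn N) i) : 'I_(s i.+1))].

Definition inv_last (e : inversion_seq N.+1 s) : 'I_(s N.+1) := e ord_max.

Lemma val_inv_rcons_lt e k (i : 'I_N.+1) (lt_iN : (i < N)%N) :
  inv_rcons e k i = e (Ordinal lt_iN) :> nat.
Proof.
rewrite ffunE /inv_rcons_fun; case: ltnP => [lt_iN'|le_Ni]; last first.
  by exfalso; move: lt_iN; rewrite ltnNge le_Ni.
by rewrite (bool_irrelevance lt_iN lt_iN').
Qed.

Lemma val_inv_rcons_max e k : inv_rcons e k ord_max = k :> nat.
Proof.
rewrite ffunE /inv_rcons_fun; case: ltnP => //= h; exfalso.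
by move: h; rewrite ltnn.
Qed.

Lemma inv_rconsK e k : inv_belast (inv_rcons e k) = e.
Proof.
apply/ffunP => i; apply: val_inj; rewrite ffunE /=.
rewrite (@val_inv_rcons_lt e k (widen_ord (leqnSn N) i) (ltn_ord i)).
exact: inv_seq_val_eq.
Qed.

Lemma inv_rcons_last e k : inv_last (inv_rcons e k) = k.
Proof. by apply: val_inj; rewrite /= val_inv_rcons_max. Qed.

Lemma inv_belastK e : inv_rcons (inv_belast e) (inv_last e) = e.
Proof.
apply/ffunP => i; apply: val_inj => /=; case: (ltnP i N) => [lt_iN|le_Ni].
  rewrite (val_inv_rcons_lt _ _ lt_iN) ffunE /=.
  exact: inv_seq_val_eq.
have -> : i = ord_max by apply: val_inj; rewrite /= -(ord_geq_max le_Ni).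
exact: val_inv_rcons_max.
Qed.

Lemma sum_inv_rcons (V : nmodType) (F : inversion_seq N.+1 s -> V) :
  \sum_e F e = \sum_(e : inversion_seq N s) \sum_(k < s N.+1) F (inv_rcons e k).
Proof.
rewrite pair_big /= (reindex (fun p => inv_rcons p.1 p.2)) //=.
exists (fun e => (inv_belast e, inv_last e)) => [[e k]|e] _ /=.
  by rewrite inv_rconsK inv_rcons_last.
exact: inv_belastK.
Qed.

End InvRcons.

Lemma inv_entryS N s (e : inversion_seq N s) (i : 'I_N) :
  inv_entry e i.+1 = e i.
Proof.
by rewrite /inv_entry /= (nth_map i) ?size_enum_ord // nth_ord_enum.
Qed.

Lemma inv_entry_rcons N s (e : inversion_seq N s) k i :
  (i <= N)%N -> inv_entry (inv_rcons e k) i = inv_entry e i.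
Proof.
case: i => // i lt_iN.
set j := widen_ord (leqnSn N) (Ordinal lt_iN).
rewrite (inv_entryS _ j) (inv_entryS _ (Ordinal lt_iN)).
exact: (@val_inv_rcons_lt _ _ e k j lt_iN).
Qed.

Lemma inv_entry_rcons_max N s (e : inversion_seq N s) k :
  inv_entry (inv_rcons e k) N.+1 = k.
Proof. by rewrite (inv_entryS _ ord_max) val_inv_rcons_max. Qed.

Lemma ascE N s (e : inversion_seq N s) :
  asc e = (\sum_(i < N) (inv_ratio e i < inv_ratio e i.+1)%R)%N.
Proof.
rewrite /asc -sum1_card big_mkcond /=; apply: eq_bigr => i _.
by rewrite inE; case: ifP.
Qed.

(** The last two ratios are compared after cross-multiplication. Using [inv_base] on the left entry
    makes [N = 0] follow the convention e_0 / s_0 = 0 / 1. *)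
Lemma asc_rcons N s (e : inversion_seq N s) (k : 'I_(s N.+1)) :
  (0 < inv_base s N)%N ->
  asc (inv_rcons e k) =
  ((inv_entry e N * s N.+1 < k * inv_base s N)%N + asc e)%N.
Proof.
move=> s_gt0; rewrite !ascE big_ord_recr /= addnC; congr (_ + _)%N; last first.
  apply: eq_bigr => i _; rewrite /inv_ratio !inv_entry_rcons //.
  exact: ltnW.
rewrite /inv_ratio inv_entry_rcons_max inv_entry_rcons //=.
have sN_gt0 : (0 < s N.+1)%N := leq_ltn_trans (leq0n k) (ltn_ord k).
by rewrite ltr_pdivrMr ?ltr0n // mulrAC ltr_pdivlMr ?ltr0n // -!natrM ltr_nat.
Qed.

Lemma inv_entry_lt N s (e : inversion_seq N s) :
  (inv_entry e N < inv_base s N)%N.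
Proof. by case: N e => // N e; rewrite (inv_entryS e ord_max) ltn_ord. Qed.

Lemma sum_inversion_seq0 (V : nmodType) s (F : inversion_seq 0 s -> V) (x : V) :
  (forall e, F e = x) -> \sum_e F e = x.
Proof.
move=> Fx; have e0 : inversion_seq 0 s by apply: finfun => -[].
rewrite (big_pred1 e0) ?Fx // => e /=.
by symmetry; apply/eqP/ffunP => -[].
Qed.

(** * Ascent polynomials and lecture hall counts *)

(* [lh N m k] should be thought of as the number of lecture hall sequences
   [0 <= l_1/s_1 <= ... <= l_N/s_N] with [l_N <= s_N * m - k]; the hypotheses
   only record that [lh] is periodic and satisfies the recurrence obtained by
   cutting off [l_(N+1)]. *)
Section LectureHall.
Variables (s : nat -> nat) (lh : nat -> nat -> nat -> int).
Variable ceil : nat -> nat -> nat.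
Hypothesis s_gt0 : forall N, (0 < s N.+1)%N.
Hypothesis lh00 : forall m, lh 0 m 0 = 1.
Hypothesis lhs : forall N m,
  lh N m (inv_base s N) = if m is m'.+1 then lh N m' 0 else 0.
Hypothesis ceil_le : forall N j, (j < s N.+1)%N -> (ceil N j <= inv_base s N)%N.
Hypothesis ceilP : forall N j k, (j < s N.+1)%N -> (k < inv_base s N)%N ->
  (k * s N.+1 < j * inv_base s N)%N = (k < ceil N j)%N.
Hypothesis lhB : forall N m j, (j < s N.+1)%N ->
  lh N.+1 m j - lh N.+1 m j.+1 = lh N m (ceil N j).

(** Whether an appended entry creates an ascent depends on the earlier entries only through the last
    one, [k]; this refinement therefore obeys a recurrence. *)
Let lastcount N m k : int :=
  \sum_(e : inversion_seq N s | inv_entry e N == k) divcoef N 'X^(asc e) m.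

Lemma inv_base_gt0 N : (0 < inv_base s N)%N.
Proof. by case: N => //= N. Qed.

Lemma sum_lastcount_all N m :
  \sum_(e : inversion_seq N s) divcoef N 'X^(asc e) m =
  \sum_(k < inv_base s N) lastcount N m k.
Proof.
rewrite (partition_big (fun e => Ordinal (inv_entry_lt e)) xpredT) //=.
Qed.

(** By [ceilP] the old last entries [k < ceil N j] are those that give an ascent. An ascent
    contributes a factor ['X], which lowers the coefficient index by one; the sums over [i] come
    from the additional factor 1 / (1 - X). *)
Lemma lastcountS N m j : (j < s N.+1)%N ->
  lastcount N.+1 m j = \sum_(k < inv_base s N)
    (if (k < ceil N j)%N
     then if m is m'.+1 then \sum_(i < m'.+1) lastcount N i k else 0
     else \sum_(i < m.+1) lastcount N i k).
Proof.
move=> lt_js; rewrite /lastcount big_mkcond sum_inv_rcons /=.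
rewrite (partition_big (fun e => Ordinal (inv_entry_lt e)) xpredT) //=.
apply: eq_bigr => k _.
transitivity (\sum_(e : inversion_seq N s | inv_entry e N == k)
   divcoef N.+1 ('X^((k < ceil N j)%N + asc e)%N) m).
  apply: eq_bigr => e /eqP/(congr1 val)/= ek.
  rewrite (bigD1 (Ordinal lt_js)) //= inv_entry_rcons_max eqxx.
  rewrite [X in _ + X]big1 => [|j' ne_j'j].
    by rewrite addr0 asc_rcons ?inv_base_gt0 //= ek ceilP.
  rewrite inv_entry_rcons_max ifN //.
case: ifP => _.
  under eq_bigr do rewrite add1n exprS divcoefXM.
  case: m => [|m]; first by rewrite big1.
  by rewrite exchange_big.
by rewrite exchange_big.
Qed.

(** In the inductive step, the sums over old last entries below [c = ceil N k] and from [c] on both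
    telescope. Only [lh N m c] survives, and [lhB] writes it as a difference. *)
Lemma lastcountE N m k : (k < inv_base s N)%N ->
  lastcount N m k = lh N m k - lh N m k.+1.
Proof.
elim: N m k => [|N IHN] m k lt_ks.
  have -> : k = 0 by case: k lt_ks.
  rewrite /lastcount (eq_bigl xpredT) => [|e]; last by rewrite eqxx.
  rewrite (@sum_inversion_seq0 _ _ _ (m == 0)%N%:R) => [|e]; last first.
    by rewrite ascE big_ord0 /= coef1.
  have := lhs 0 m; rewrite /= => ->; rewrite lh00.
  by case: m => [|m]; rewrite ?subr0 // lh00 subrr.
rewrite lastcountS // lhB //; set c := ceil N k.
have le_cs : (c <= inv_base s N)%N := ceil_le lt_ks.
have low i : \sum_(k < c) lastcount N i k = lh N i 0 - lh N i c.
  rewrite (eq_bigr (fun k : 'I_c => lh N i k - lh N i k.+1)) => [|j _].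
    rewrite -(big_mkord xpredT (fun k => lh N i k - lh N i k.+1)).
    rewrite -[RHS]opprB -telescope_sumr // -sumrN.
    by apply: eq_bigr => j _; rewrite opprB.
  by rewrite IHN // (leq_trans (ltn_ord j)).
have high i : \sum_(c <= k < inv_base s N) lastcount N i k =
    lh N i c - (if i is i'.+1 then lh N i' 0 else 0).
  rewrite -lhs -[RHS]opprB -telescope_sumr // -sumrN !big_nat.
  by apply: eq_bigr => j /andP[_ lt_j]; rewrite IHN // opprB.
pose F k := if (k < c)%N
  then if m is m'.+1 then \sum_(i < m'.+1) lastcount N i k else 0
  else \sum_(i < m.+1) lastcount N i k.
rewrite -(big_mkord xpredT F) (big_cat_nat (leq0n c) le_cs) /=.
have -> : \sum_(c <= k < inv_base s N) F k =
    \sum_(i < m.+1) \sum_(c <= k < inv_base s N) lastcount N i k.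
  rewrite exchange_big /= !big_nat; apply: eq_bigr => j /andP[le_cj _].
  by rewrite /F ltnNge le_cj.
have -> : \sum_(0 <= k < c) F k = \sum_(k < c)
    if m is m'.+1 then \sum_(i < m'.+1) lastcount N i k else 0.
  by rewrite big_mkord; apply: eq_bigr => j _; rewrite /F ltn_ord.
under [X in _ + X]eq_bigr do rewrite high.
case: m @F => [|m] _; first by rewrite big1 // big_ord1 add0r subr0.
rewrite exchange_big /=; under eq_bigr do rewrite low.
(* The [lh _ _ 0] terms cancel after the index shift supplied by [lhs], and the [lh _ _ c] terms
   cancel except for the largest index. *)
rewrite !sumrB [X in _ + (X - _)]big_ord_recr [X in _ + (_ - X)]big_ord_recl /=.
ring.
Qed.

(** Summed over all last entries, [lastcountE] telescopes to [lh N i 0] minus the same count at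
    [i - 1]; the extra factor 1 / (1 - X) then telescopes over [i]. *)
Lemma divcoef_asc N m :
  divcoef N.+1 (\sum_(e : inversion_seq N s) 'X^(asc e)) m = lh N m 0.
Proof.
rewrite /=; under eq_bigr do rewrite divcoef_sum sum_lastcount_all.
transitivity (\sum_(i < m.+1)
   (lh N i 0 - if (i : nat) is i'.+1 then lh N i' 0 else 0)).
  apply: eq_bigr => i _; rewrite -lhs -[RHS]opprB -telescope_sumr //.
  rewrite -sumrN big_mkord; apply: eq_bigr => k _.
  by rewrite lastcountE // opprB.
rewrite sumrB big_ord_recr [X in _ - X]big_ord_recl /=; ring.
Qed.

End LectureHall.

(** * Closed product formulas for 1, 4, 3, 8, .. *)

(* The lecture hall counts [lh N m k] of the section above for [s_1438]. They
  always factor over [2m-1], [m], [2m+1] and [m+1]. *)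
Definition lh_odd (n m k : nat) : int :=
  if (k <= n.+1)%N then
    m%:Z ^+ k * (2 * m%:Z + 1) ^+ n * (m%:Z + 1) ^+ (n.+1 - k)
  else
    (2 * m%:Z - 1) ^+ (k - n.+1) * m%:Z ^+ n.+1
    * (2 * m%:Z + 1) ^+ (2 * n + 1 - k).

Definition lh_even (n m k : nat) : int :=
  if (k <= 2 * n)%N then
    if odd k
    then 2 * m%:Z ^+ k./2.+1 * (2 * m%:Z + 1) ^+ n.-1 * (m%:Z + 1) ^+ (n - k./2)
    else m%:Z ^+ k./2 * (2 * m%:Z + 1) ^+ n * (m%:Z + 1) ^+ (n - k./2)
  else
    if odd k
    then 2 * (2 * m%:Z - 1) ^+ (k./2 - n) * m%:Z ^+ n.+1
         * (2 * m%:Z + 1) ^+ (2 * n - k./2).-1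
    else (2 * m%:Z - 1) ^+ (k./2 - n) * m%:Z ^+ n
         * (2 * m%:Z + 1) ^+ (2 * n - k./2).

(** For [N = 0] and [k <= 1], the empty sequence counts exactly when 0 <= m - k. *)
Definition lh_1438 (N m k : nat) : int :=
  if N is 0 then if (k == 0)%N then 1 else (0 < m)%N%:R
  else if odd N then lh_odd N./2 m k else lh_even N./2 m k.

(* [ceil_1438 N j] is the ceiling of [j * s_N / s_(N+1)]. *)
Definition ceil_1438 (N j : nat) : nat :=
  if N is 0 then j
  else if odd N then if (j < N.+1)%N then uphalf j else j./2
  else if (j <= N./2)%N then (2 * j)%N else (2 * j)%N.-1.


Lemma lh_odd_lo n m k : (k <= n.+1)%N ->
  lh_odd n m k = m%:Z ^+ k * (2 * m%:Z + 1) ^+ n * (m%:Z + 1) ^+ (n.+1 - k).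
Proof. by rewrite /lh_odd => ->. Qed.

Lemma lh_odd_hi n m q :
  lh_odd n m (n.+1 + q) =
  (2 * m%:Z - 1) ^+ q * m%:Z ^+ n.+1 * (2 * m%:Z + 1) ^+ (n - q).
Proof.
rewrite /lh_odd; case: q => [|q].
  by rewrite addn0 leqnn subnn !expr0 subn0 mul1r mulr1.
rewrite ifN; last lia.
by congr (_ ^+ _ * _ * _ ^+ _); lia.
Qed.

Lemma lh_even_double_lo n m p : (p <= n)%N ->
  lh_even n m p.*2 = m%:Z ^+ p * (2 * m%:Z + 1) ^+ n * (m%:Z + 1) ^+ (n - p).
Proof. by move=> le_pn; rewrite /lh_even odd_double doubleK ifT //; lia. Qed.

Lemma lh_even_doubleS_lo n m p : (p < n)%N ->
  lh_even n m p.*2.+1 =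
  2 * m%:Z ^+ p.+1 * (2 * m%:Z + 1) ^+ n.-1 * (m%:Z + 1) ^+ (n - p).
Proof.
by move=> lt_pn; rewrite /lh_even /= odd_double /= uphalf_double ifT //; lia.
Qed.

Lemma lh_even_double_hi n m q :
  lh_even n m (n + q).*2 =
  (2 * m%:Z - 1) ^+ q * m%:Z ^+ n * (2 * m%:Z + 1) ^+ (n - q).
Proof.
rewrite /lh_even odd_double doubleK; case: q => [|q].
  by rewrite addn0 ifT ?subnn ?subn0 ?expr0 ?mulr1 ?mul1r //; lia.
rewrite ifN; last lia.
by congr (_ ^+ _ * _ * _ ^+ _); lia.
Qed.

Lemma lh_even_doubleS_hi n m q :
  lh_even n m (n + q).*2.+1 =
  2 * (2 * m%:Z - 1) ^+ q * m%:Z ^+ n.+1 * (2 * m%:Z + 1) ^+ (n - q).-1.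
Proof.
rewrite /lh_even /= odd_double /= uphalf_double ifN; last lia.
by congr (_ * _ ^+ _ * _ * _ ^+ _); lia.
Qed.

(** After the common factors are taken out, the difference is (2m+1) - 2m or 2(m+1) - (2m+1) in the
    lower range, and (2m+1) - 2m or 2m - (2m-1) in the upper one; each equals 1. *)
Lemma lh_evenB n m j : (j < 4 * n.+1)%N ->
  lh_even n.+1 m j - lh_even n.+1 m j.+1 =
  lh_odd n m (if (j < 2 * n.+1)%N then uphalf j else j./2).
Proof.
move=> lt_j; rewrite uphalf_half -(odd_double_half j).
move: (odd j) (j./2) (odd_double_half j) => b p Ej; subst j.
rewrite half_bit_double.
have -> : odd (b + p.*2) = b by case: b {lt_j}; rewrite /= odd_double.
case: (ltnP p n.+1) => [le_pn|lt_np].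
  rewrite ifT; last by case: b {lt_j}; lia.
  (* Naming the difference [r] removes truncated subtraction from the exponents, so that [ring]
     applies. *)
  have [r ->] : exists r, n = (p + r)%N by exists (n - p)%N; lia.
  case: b lt_j => _; rewrite ?add0n ?add1n.
    rewrite -doubleS lh_even_doubleS_lo ?lh_even_double_lo ?lh_odd_lo; try lia.
    have -> : ((p + r).+1 - p = r.+1)%N by lia.
    have -> : ((p + r).+1 - p.+1 = r)%N by lia.
    by rewrite /= !exprS; ring.
  rewrite lh_even_doubleS_lo ?lh_even_double_lo ?lh_odd_lo; try lia.
  by rewrite /= !exprS; ring.
rewrite ifN; last by case: b {lt_j}; lia.
have [q Ep] : exists q, p = (n.+1 + q)%N by exists (p - n.+1)%N; lia.
subst p; have [r En] : exists r, n = (q + r)%N.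
  by exists (n - q)%N; case: b lt_j; lia.
have Hr : (n.+1 - q = r.+1)%N by lia.
have Hr' : (n.+1 - q.+1 = r)%N by lia.
have Hr'' : (n - q = r)%N by lia.
case: b {lt_j lt_np}; rewrite ?add0n ?add1n.
  rewrite -doubleS -addnS lh_even_doubleS_hi lh_even_double_hi lh_odd_hi.
  by rewrite Hr Hr' Hr'' /= !exprS; ring.
rewrite lh_even_doubleS_hi lh_even_double_hi lh_odd_hi.
by rewrite Hr Hr'' /= !exprS; ring.
Qed.

(** Raising [j] by one trades a factor m+1 for m while [j <= n], and 2m+1 for 2m-1 afterwards; the
    difference keeps the other factors, times 1 or 2 respectively. *)
Lemma lh_oddB n m j : (0 < n)%N -> (j < 2 * n + 1)%N ->
  lh_odd n m j - lh_odd n m j.+1 =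
  lh_even n m (if (j <= n)%N then 2 * j else (2 * j).-1)%N.
Proof.
move=> n_gt0 lt_j; case: leqP => [le_jn|lt_nj].
  have [r En] : exists r, n = (j + r)%N by exists (n - j)%N; lia.
  rewrite mul2n !lh_odd_lo ?lh_even_double_lo //; try lia.
  have -> : (n.+1 - j = r.+1)%N by lia.
  have -> : (n.+1 - j.+1 = r)%N by lia.
  have -> : (n - j = r)%N by lia.
  by rewrite !exprS; ring.
have [q Ej] : exists q, j = (n.+1 + q)%N by exists (j - n.+1)%N; lia.
have [r En] : exists r, n = (q + r.+1)%N by exists (n - q.+1)%N; lia.
rewrite Ej -addnS !lh_odd_hi.
have -> : ((2 * (n.+1 + q)).-1 = (n + q).*2.+1)%N by lia.
rewrite lh_even_doubleS_hi.
have -> : (n - q = r.+1)%N by lia.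
have -> : (n - q.+1 = r)%N by lia.
by rewrite !exprS /=; ring.
Qed.

Lemma s_1438_gt0 N : (0 < s_1438 N.+1)%N.
Proof.
by rewrite /s_1438; case: ifP => // oddN; move: (odd_double_half N.+1); lia.
Qed.

Lemma s_1438_odd n : s_1438 n.*2.+1 = n.*2.+1.
Proof. by rewrite /s_1438 /= odd_double. Qed.

Lemma s_1438_even n : s_1438 n.*2 = (4 * n)%N.
Proof. by rewrite /s_1438 odd_double doubleK. Qed.

Lemma nat_parity_ind (P : nat -> Prop) :
  P 0 -> (forall n, P n.*2.+1) -> (forall n, P n.+1.*2) -> forall N, P N.
Proof.
move=> P0 Podd Peven N; rewrite -(odd_double_half N).
by case: (odd N) => //; rewrite add0n; case: N./2.
Qed.

(** At the full period every 2m+1 has become 2m-1 and every m+1 has become m, which are the same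
    factors taken at m-1. For [m = 0] the power of m vanishes. *)
Lemma lh_1438_period N m :
  lh_1438 N m (inv_base s_1438 N) = if m is m'.+1 then lh_1438 N m' 0 else 0.
Proof.
elim/nat_parity_ind: N => [|n|n]; first by case: m.
  rewrite /= s_1438_odd odd_double /= uphalf_double.
  have -> : (n.*2.+1 = n.+1 + n)%N by lia.
  rewrite lh_odd_hi subnn expr0 mulr1; case: m => [|m].
    by rewrite (expr0n _ n.+1) mulr0.
  rewrite lh_odd_lo // subn0 expr0 mul1r; congr (_ ^+ _ * _ ^+ _); lia.
rewrite /inv_base /lh_1438 s_1438_even odd_double doubleK doubleS.
have -> : (4 * n.+1 = (n.+1 + n.+1).*2)%N by lia.
rewrite lh_even_double_hi subnn expr0 mulr1; case: m => [|m].
  by rewrite (expr0n _ n.+1) mulr0.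
rewrite (@lh_even_double_lo _ _ 0) // subn0 expr0 mul1r.
by congr (_ ^+ _ * _ ^+ _); lia.
Qed.

Lemma ceil_1438_le N j :
  (j < s_1438 N.+1)%N -> (ceil_1438 N j <= inv_base s_1438 N)%N.
Proof.
elim/nat_parity_ind: N => [|n|n].
- by rewrite /s_1438 /=; lia.
- rewrite -doubleS s_1438_even /= s_1438_odd odd_double uphalf_half /=.
  by move: (odd_double_half j); case: ifP; lia.
- rewrite s_1438_odd /inv_base /ceil_1438 doubleS -doubleS s_1438_even.
  by rewrite odd_double doubleK; case: ifP; lia.
Qed.

Lemma ceil_1438P N j k :
  (j < s_1438 N.+1)%N -> (k < inv_base s_1438 N)%N ->
  (k * s_1438 N.+1 < j * inv_base s_1438 N)%N = (k < ceil_1438 N j)%N.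
Proof.
elim/nat_parity_ind: N => [|n|n].
- by rewrite /s_1438 /=; lia.
- rewrite -doubleS s_1438_even /= s_1438_odd odd_double uphalf_half /=.
  move: (odd j) (j./2) (odd_double_half j) => b p <-{j} lt_j lt_k.
  by case: b lt_j; case: ifP => /= lt_j2 lt_j; apply/idP/idP => h; nia.
- rewrite s_1438_odd /inv_base /ceil_1438 doubleS -doubleS s_1438_even.
  rewrite odd_double doubleK => lt_j lt_k; case: (leqP j n.+1) => le_jn.
    case: (leqP (2 * j) k) => le_k.
      by have := leq_mul le_k (leqnn n.+1.*2.+1); lia.
    by have := leq_mul le_k (leqnn n.+1.*2.+1); lia.
  case: (ltnP k (2 * j).-1) => le_k.
    have le_k2 : (k.+2 <= 2 * j)%N by lia.
    by have := leq_mul le_k2 (leqnn n.+1.*2.+1); lia.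
  have le_k2 : (2 * j <= k.+1)%N by lia.
  by have := leq_mul le_k2 (leqnn n.+1.*2.+1); lia.
Qed.

Lemma lh_1438B N m j : (j < s_1438 N.+1)%N ->
  lh_1438 N.+1 m j - lh_1438 N.+1 m j.+1 = lh_1438 N m (ceil_1438 N j).
Proof.
elim/nat_parity_ind: N => [|n|n].
- case: j => // _; rewrite /= /lh_odd /= !expr0 !expr1; ring.
- rewrite -doubleS s_1438_even => lt_j.
  rewrite [lh_1438 _ m _]/lh_1438 [lh_1438 _ m j.+1]/lh_1438 doubleS -doubleS.
  rewrite odd_double doubleK lh_evenB //= odd_double uphalf_double.
  by have -> : (n.*2.+2 = 2 * n.+1)%N by lia.
- rewrite s_1438_odd => lt_j.
  rewrite /lh_1438 {1 2}/odd -/odd odd_double /= uphalf_double doubleK.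
  by rewrite lh_oddB ?odd_double //; lia.
Qed.

Lemma divcoef_asc_1438 n m : (0 < n)%N ->
  divcoef (2 * n).+1 (\sum_(e : inversion_seq (2 * n) s_1438) 'X^(asc e)) m =
  (((2 * m).+1 * m.+1) ^ n)%N.
Proof.
case: n => // n _; rewrite (divcoef_asc s_1438_gt0 _ lh_1438_period ceil_1438_le
  ceil_1438P lh_1438B) //.
rewrite mul2n /lh_1438 doubleS -doubleS odd_double doubleK.
rewrite (@lh_even_double_lo _ _ 0) // subn0 expr0 mul1r -exprMn.
by rewrite -[RHS]natz natrX; congr (_ ^+ _); rewrite natz; lia.
Qed.

(** * Counting sorted tuples in which every key occurs twice *)

Section SortedTuples.
Variables (T J : finType) (r : rel T) (key : T -> J) (p : pred T).
Hypotheses (r_total : total r) (r_trans : transitive r).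
Hypothesis r_anti : antisymmetric r.

(** The ordered pairs and their mirror images cover [A] times [A] and meet in the diagonal, so twice
    the count is |A|^2 + |A|. *)
Lemma card_le_pairs (A : {set T}) :
  #|[set x : T * T | [&& x.1 \in A, x.2 \in A & r x.1 x.2]]| = 'C(#|A|.+1, 2).
Proof.
set L := [set x | _].
pose L' := [set x : T * T | [&& x.1 \in A, x.2 \in A & r x.2 x.1]].
have cL' : #|L'| = #|L|.
  have -> : L' = (fun x => (x.2, x.1)) @: L.
    apply/setP => -[x y]; apply/idP/imsetP => [|[[x' y'] + [-> ->]]].
      by rewrite inE /= => /and3P[Ax Ay rxy]; exists (y, x); rewrite ?inE //= Ax Ay.
    by rewrite !inE /= => /and3P[-> -> ->].
  by apply: card_imset => -[x y] [x' y'] /= [-> ->].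
have LU : L :|: L' = setX A A.
  apply/setP => -[x y]; rewrite !inE /=.
  by case: (x \in A); case: (y \in A) => //=; apply: r_total.
have LI : L :&: L' = (fun x => (x, x)) @: A.
  apply/setP => -[x y]; rewrite !inE /=; apply/idP/imsetP => [|[z Az [-> ->]]].
    case/andP=> /and3P[Ax Ay rxy] /and3P[_ _ ryx]; exists x => //.
    by congr (_, _); apply: r_anti; rewrite ryx rxy.
  by rewrite Az /= andbb; have := r_total z z; rewrite orbb => ->.
have := cardsUI L L'; rewrite LU LI cL' cardsX card_imset => [|x y [->] //].
by rewrite bin2 /= => h; lia.
Qed.

Definition key_pairs (j : J) : {set T * T} :=
  [set x | [&& x.1 \in [set y | p y & key y == j],
               x.2 \in [set y | p y & key y == j] & r x.1 x.2]].

Definition sorted_doubles N : {set N.-tuple T} :=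
  [set z : N.-tuple T | [&& all p z, sorted r z &
    perm_eq (map key z) (flatten [seq [:: j; j] | j <- enum J])]].

Definition flat_pairs (f : {ffun J -> T * T}) : seq T :=
  flatten [seq [:: (f j).1; (f j).2] | j <- enum J].

Lemma size_flat_pairs f : size (flat_pairs f) = (2 * #|J|)%N.
Proof.
rewrite /flat_pairs size_flatten /shape -map_comp cardE.
by elim: (enum J) => //= j s ->; rewrite mulnS.
Qed.

Lemma filter_flat_pairs (f : {ffun J -> T * T}) j :
  (forall j, f j \in key_pairs j) ->
  [seq x <- flat_pairs f | key x == j] = [:: (f j).1; (f j).2].
Proof.
move=> fP; rewrite /flat_pairs filter_flatten -map_comp.
have keyf i : (key (f i).1 = i) /\ (key (f i).2 = i).
  by have := fP i; rewrite !inE => /and3P[/andP[_ /eqP->] /andP[_ /eqP->] _].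
have E i : ([seq x <- [:: (f i).1; (f i).2] | key x == j]
    = if i == j then [:: (f j).1; (f j).2] else [::]).
  by have [k1 k2] := keyf i; rewrite /= k1 k2; case: eqP => [->|].
rewrite (eq_map E) /=.
have := enum_uniq J; have : j \in enum J by rewrite mem_enum.
elim: (enum J) => //= i s IHs; rewrite inE => /orP[/eqP<-|js] /andP[nis us].
  rewrite eqxx.
  suff -> : [seq (if i == j then [:: (f j).1; (f j).2] else [::]) | i <- s] =
      nseq (size s) [::].
    by elim: (s).
  elim: s nis {IHs us} => //= i1 s IHs; rewrite inE negb_or => /andP[ne nis].
  by rewrite eq_sym (negPf ne) IHs.
by rewrite ifN ?IHs //; apply: contraNneq nis => ->.
Qed.

Lemma perm_flatten_filter (s : seq T) :
  perm_eq s (flatten [seq [seq x <- s | key x == j] | j <- enum J]).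
Proof.
apply/allP => x _ /=; rewrite count_flatten -map_comp sumnE big_map.
rewrite big_enum /= (bigD1 (key x)) //= big1 => [|j ne_j].
  rewrite addn0 count_filter; apply/eqP/eq_count => y /=.
  by case: (y =P x) => //= ->; rewrite eqxx.
apply/eqP; rewrite -leqn0 -[leqRHS](count_pred0 s) count_filter.
by apply: sub_count => y /= /andP[/eqP-> /eqP E]; rewrite E eqxx in ne_j.
Qed.

Lemma count_doubles (j : J) :
  count_mem j (flatten [seq [:: j; j] | j <- enum J]) = 2.
Proof.
rewrite count_flatten -map_comp sumnE big_map big_enum /= (bigD1 j) //= eqxx.
by rewrite big1 // => i /negPf ->.
Qed.

(** A sorted tuple is determined by its multiset of entries, which splits by key into independent
    two-element multisets, each represented by its ordered pair. *)
Lemma card_sorted_doubles N : N = (2 * #|J|)%N ->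
  #|sorted_doubles N| = (\prod_j 'C(#|[set x | p x & key x == j]|.+1, 2))%N.
Proof.
move=> ->.
have szF f : size (sort r (flat_pairs f)) == (2 * #|J|)%N.
  by rewrite size_sort size_flat_pairs.
pose F f : (2 * #|J|).-tuple T := Tuple (szF f).
have -> : sorted_doubles _ = F @: [set f | f \in family key_pairs].
  apply/setP => z; apply/idP/imsetP.
    rewrite inE => /and3P[/allP pz rz kz].
    (* The entries of [z] with key [j] form a sorted subsequence of length two, which is the
       required pair. *)
    have zj j : exists x, [/\ x \in key_pairs j &
        [seq y <- z | key y == j] = [:: x.1; x.2]].
      have szj : size [seq y <- z | key y == j] = 2.
        rewrite size_filter -(count_doubles j) -(permP kz) count_map.
        by apply: eq_count.
      have zjP y : y \in [seq y <- z | key y == j] -> p y && (key y == j).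
        by rewrite mem_filter => /andP[-> /pz->].
      have := sorted_filter r_trans (fun y => key y == j) rz.
      case: [seq y <- z | key y == j] szj zjP => [|x [|y [|]]] //= _ zjP.
      rewrite andbT => rxy; exists (x, y); split=> //.
      by rewrite !inE /= rxy !zjP ?inE ?eqxx ?orbT.
    have [f fP] := fin_all_exists zj.
    exists (finfun f).
      by rewrite inE; apply/familyP => j; rewrite ffunE; case: (fP j).
    apply: val_inj => /=; apply: (sorted_eq r_trans r_anti) => //.
      exact: sort_sorted.
    rewrite perm_sym perm_sort perm_sym /flat_pairs.
    rewrite (eq_map (g := fun j => [seq y <- z | key y == j])) => [|j].
      exact: perm_flatten_filter.
    by rewrite ffunE; case: (fP j).
  case=> f; rewrite inE => /familyP fP ->; rewrite inE /= sort_sorted //=.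
  have fP' j : [/\ p (f j).1, p (f j).2, key (f j).1 = j & key (f j).2 = j].
    by have := fP j; rewrite !inE => /and3P[/andP[-> /eqP->] /andP[-> /eqP->] _].
  apply/andP; split.
    rewrite all_sort; apply/allP => x /flattenP[_ /mapP[j _ ->]].
    by have [p1 p2 _ _] := fP' j; rewrite !inE => /orP[] /eqP->.
  rewrite (perm_trans (y := map key (flat_pairs f))) //.
    by apply: perm_map; rewrite perm_sort.
  rewrite /flat_pairs map_flatten -map_comp.
  rewrite (eq_map (g := fun j => [:: j; j])) // => j /=.
  by have [_ _ -> ->] := fP' j.
rewrite card_in_imset; last first.
  move=> f g; rewrite !inE => /familyP fP /familyP gP /(congr1 val)/= E.
  (* Filtering by key commutes with sorting, and each pair is already sorted, so the sorted tuple
     returns [f j]. *)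
  apply/ffunP => j; have := congr1 (filter (fun x => key x == j)) E.
  rewrite !filter_sort // !filter_flat_pairs //.
  rewrite !(sorted_sort r_trans) /= ?andbT; last 2 first.
  - by have := gP j; rewrite inE => /and3P[].
  - by have := fP j; rewrite inE => /and3P[].
  by case: (f j) (g j) => [a b] [c d] /= [-> ->].
rewrite cardsE card_family foldrE big_map big_enum /=.
by apply: eq_bigr => j _; exact: card_le_pairs.
Qed.

End SortedTuples.

(** * Lexicographic order and descents *)

Definition lexle (x y : nat * int) : bool :=
  (x.1 < y.1)%N || (x.1 == y.1) && (x.2 <= y.2).

Lemma lexle_total : total lexle.
Proof.
move=> [a x] [b y]; rewrite /lexle /=.
by case: ltngtP => //= _; apply: le_total.
Qed.

Lemma lexle_trans : transitive lexle.
Proof.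
move=> [b y] [a x] [c z]; rewrite /lexle /=.
case: (ltngtP a b) => //= [ltab|->] => [_|lexy].
  case/orP=> [ltbc|/andP[/eqP<- _]]; last by rewrite ltab.
  by rewrite (ltn_trans ltab ltbc).
by case: ltngtP => //= _; apply: le_trans.
Qed.

Lemma lexle_anti : antisymmetric lexle.
Proof.
move=> [a x] [b y]; rewrite /lexle /=; case: ltngtP => //= -> le_xy.
by congr (_, _); apply: le_anti.
Qed.

(** The preceding letter is a parameter, so that words can be consumed from the left; starting at 0
    gives the convention pi_0 = 0. *)
Fixpoint des_from (x : int) (w : seq int) : nat :=
  if w is y :: w' then ((y < x)%R + des_from y w')%N else 0%N.

Lemma des_fromE w : des w = des_from 0 w.
Proof.
have dE x : (\sum_(i < size w) (nth 0 (x :: w) i.+1 < nth 0 (x :: w) i)%R)%N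
    = des_from x w.
  elim: w x => [|y w IHw] x /=; first by rewrite big_ord0.
  by rewrite big_ord_recl /= -IHw.
rewrite -dE /des -sum1_card big_mkcond /=; apply: eq_bigr => i _.
by rewrite inE; case: ifP.
Qed.

Lemma sum_tuple_cons (V : nmodType) (T : finType) N (F : N.+1.-tuple T -> V) :
  \sum_t F t = \sum_x \sum_(t : N.-tuple T) F [tuple of x :: t].
Proof.
rewrite pair_big /= (reindex (fun q : T * N.-tuple T => [tuple of q.1 :: q.2])) //=.
exists (fun t => (thead t, [tuple of behead t])) => [[x t]|t] _ /=.
  by congr (_, _); apply: val_inj.
by rewrite -tuple_eta.
Qed.

Lemma sum_ord_geq (V : nmodType) (m u : nat) (g : nat -> V) :
  \sum_(i < m.+1 | (u <= i)%N) g (m - i)%N = \sum_(i < m.+1 - u) g i.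
Proof.
rewrite (reindex_inj rev_ord_inj) /= (big_ord_widen m.+1 g) ?leq_subr //.
apply: eq_big => [i|i _]; first by have := ltn_ord i; lia.
by congr g; have := ltn_ord i; lia.
Qed.

(* The [lexle] path condition says that [v, c_1, ..., c_N] is weakly increasing,
   and strictly so at the descents of [x :: w]. *)
Lemma divcoef_des_from m N (w : seq int) (x : int) (v : nat) :
  size w = N -> (v <= m)%N ->
  divcoef N.+1 'X^(des_from x w) (m - v) =
  \sum_(c : N.-tuple 'I_m.+1) (path lexle (v, x) (zip (map val c) w))%:R.
Proof.
elim: w N x v => [|y w IHw] [|N] x v //= => [_|[size_w]] le_vm.
  rewrite (big_pred1 [tuple]) => [|c]; last by apply/esym/eqP/tuple0.
  rewrite big_ord_recl /= coef1 big1 ?addr0 // => i _.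
  by rewrite coef1.
rewrite sum_tuple_cons /=.
have -> : \sum_(v1 < m.+1) \sum_(c : N.-tuple 'I_m.+1)
   (lexle (v, x) (val v1, y) && path lexle (val v1, y) (zip (map val c) w))%:R =
   \sum_(v1 < m.+1 | (v + (y < x)%R <= v1)%N)
      divcoef N.+1 'X^(des_from y w) (m - v1) :> int.
  rewrite [RHS]big_mkcond; apply: eq_bigr => v1 _.
  have -> : lexle (v, x) (val v1, y) = (v + (y < x)%R <= v1)%N.
    rewrite /lexle /= leNgt; case: (y < x); rewrite ?andbT ?andbF ?orbF.
      by rewrite addn1.
    by rewrite orbC addn0 -leq_eqVlt.
  case: ifP => _; last by rewrite big1.
  by rewrite IHw //; rewrite -ltnS.
rewrite (sum_ord_geq m _ (divcoef N.+1 'X^(des_from y w))).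
(* Without a descent the range has [m - v + 1] terms, exactly one more partial summation; a descent
   removes one term, which matches its factor ['X]. *)
case: (y < x); last by rewrite add0n addn0 subSn.
rewrite add1n exprS addn1 subSS.
transitivity (divcoef N.+2 ('X * 'X^(des_from y w)) (m - v)) => //.
by rewrite divcoefXM; case: (m - v)%N => //; rewrite big_ord0.
Qed.

(** * Signed words and marked letters *)

Section SignedWords.
Variables n m : nat.

Let mark (x : 'I_m.+1 * letter n) : nat * int := (val x.1, letter_val x.2).

Lemma letter_val_inj : injective (@letter_val n).
Proof.
move=> [[] i] [[] j]; rewrite /letter_val /= ?expr1 ?expr0 ?mul1r ?mulN1r => E;
  by [congr (_, _); apply: val_inj => /=; lia | exfalso; lia].
Qed.

Lemma absz_letter_val (x : letter n) : absz (letter_val x) = x.2.+1.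
Proof. by case: x => [[] i]; rewrite /letter_val /= ?expr1 ?expr0; lia. Qed.

Lemma zip_mark (c : seq 'I_m.+1) (w : seq (letter n)) :
  zip (map val c) (word_val w) = map mark (zip c w).
Proof. by elim: c w => [|v c IHc] [|x w] //=; rewrite IHc. Qed.

Lemma content_double (w : seq (letter n)) :
  perm_eq [seq absz x | x <- word_val w] (double_multiset n) =
  perm_eq (map snd w) (flatten [seq [:: j; j] | j <- enum 'I_n]).
Proof.
have -> : [seq absz x | x <- word_val w] = map (succn \o val) (map snd w).
  by rewrite /word_val -!map_comp; apply: eq_map => x /=; rewrite absz_letter_val.
have -> : double_multiset n =
    map (succn \o val) (flatten [seq [:: j; j] | j <- enum 'I_n]).
  rewrite /double_multiset map_flatten -map_comp -[1%N]addn0 iotaDl -val_enum_ord.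
  by rewrite -!map_comp.
apply/idP/idP => [|/perm_map //]; apply: perm_map_inj => i j [] /val_inj //.
Qed.

(** Of the 2(m+1) choices of a value and a sign, only value 0 with the negative sign, encoded as
    [true], lies below (0, 0). *)
Lemma card_marked_letter (j : 'I_n) :
  #|[set x | lexle (0%N, 0) (mark x) & x.2.2 == j]| = (2 * m).+1.
Proof.
have -> : [set x | lexle (0%N, 0) (mark x) & x.2.2 == j] =
    (fun u : 'I_m.+1 * bool => (u.1, (u.2, j))) @: [set~ (ord0, true)].
  apply/setP => -[v [b i]]; apply/idP/imsetP.
    rewrite inE /= => /andP[p_x /eqP->]; exists (v, b) => //.
    rewrite !inE; apply: contraTneq p_x => -[-> ->].
    by rewrite /lexle /= /letter_val /=.
  case=> -[v' b']; rewrite !inE => ne [-> -> ->]; rewrite eqxx andbT /lexle /=.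
  case: (posnP v') => //= v'0; move: ne; have -> : v' = ord0 by apply: val_inj.
  by case: b' => //; rewrite ?eqxx // /letter_val /= expr0 mul1r.
rewrite card_imset => [|[v b] [v' b'] [-> ->] //].
by rewrite cardsC1 card_prod card_ord card_bool; lia.
Qed.

(** Zipping the values [c] with the word [w] gives a sorted tuple whose key is the letter without
    its sign. Each key contributes C(2m+2, 2) = (2m+1)(m+1). *)
Lemma divcoef_signed_multiperm :
  divcoef (2 * n).+1 (\sum_(w in signed_multiperm n) 'X^(des (word_val w))) m =
  (((2 * m).+1 * m.+1) ^ n)%N.
Proof.
rewrite divcoef_sum.
pose r := relpre mark lexle; pose p x := lexle (0%N, 0) (mark x).
pose key (x : 'I_m.+1 * letter n) := x.2.2.
have r_anti : antisymmetric r.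
  move=> [a x] [b y] /lexle_anti; rewrite /mark /= => -[E1 E2].
  by rewrite (val_inj E1) (letter_val_inj E2).
transitivity (#|sorted_doubles r key p (2 * n)|%:R : int); last first.
  rewrite card_sorted_doubles ?card_ord //; last first.
  - by move=> x y z; apply: lexle_trans.
  - by move=> x y; apply: lexle_total.
  rewrite natz (eq_bigr (fun=> ((2 * m).+1 * m.+1)%N)) => [|j _].
    by rewrite prod_nat_const card_ord.
  by rewrite card_marked_letter bin2 /=; lia.
rewrite -sum1_card natr_sum big_mkcond /=.
transitivity (\sum_(w : (2 * n).-tuple (letter n))
  \sum_(c : (2 * n).-tuple 'I_m.+1)
   ([tuple of zip c w] \in sorted_doubles r key p (2 * n))%:R : int); last first.
  rewrite pair_big /= [RHS]big_mkcond.
  rewrite [RHS](reindex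
    (fun q : (2 * n).-tuple (letter n) * (2 * n).-tuple 'I_m.+1 =>
       [tuple of zip q.2 q.1])) /=.
    by apply: eq_bigr => q _; case: ifP.
  exists (fun z : (2 * n).-tuple ('I_m.+1 * letter n) =>
    ([tuple of map snd z], [tuple of map fst z])) => [[w c]|z] _ /=.
    by congr (_, _); apply: val_inj => /=;
      [apply: unzip2_zip | apply: unzip1_zip]; rewrite !size_tuple.
  by apply: val_inj => /=; rewrite zip_unzip.
rewrite big_mkcond; apply: eq_bigr => w _.
have E (c : (2 * n).-tuple 'I_m.+1) :
    ([tuple of zip c w] \in sorted_doubles r key p (2 * n)) =
    (w \in signed_multiperm n)
    && path lexle (0%N, 0) (zip (map val c) (word_val w)).
  (* By transitivity, a path from (0, 0) is a sorted sequence whose entries are all at least (0,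
     0). *)
  rewrite !inE content_double zip_mark (path_sortedE lexle_trans).
  rewrite all_map sorted_map /= andbA andbC; congr (_ && _).
  have -> : map key (zip c w) = map snd (unzip2 (zip c w)) by rewrite -map_comp.
  by rewrite unzip2_zip // !size_tuple.
under [RHS]eq_bigr do rewrite E.
case: ifP => _; last by rewrite big1.
by rewrite des_fromE -divcoef_des_from ?subn0 // size_map size_tuple.
Qed.

End SignedWords.

Theorem theorem1p2 (n : nat) (hn : (1 <= n)%N) :
  \sum_(w in signed_multiperm n) 'X^(des (word_val w)) =
  \sum_(e : inversion_seq (2 * n) s_1438) 'X^(asc e) :> {poly int}.
Proof.
apply: (@divcoef_inj (2 * n).+1) => m.
by rewrite divcoef_signed_multiperm divcoef_asc_1438.
Qed.
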